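(* Let $k \ge 0$ be an integer and let $G$ be a finite simple connected graph with diameter $d(G)=2k+1$. Then $2n(G)\geq d(G)+1$.
   Context: All graphs are finite, simple, undirected and connected. For a graph $G$, $n(G)$ denotes the negative inertia index of $G$, i.e. the number of negative eigenvalues, counted with multiplicity, of the adjacency matrix $A(G)$. $d(G)$ denotes the diameter of $G$. *)

(* Defs.v *)
From HB Require Import structures.
From mathcomp Require Import all_boot all_order all_algebra.
From mathcomp Require Import polyrcf.
Set Implicit Arguments.
Unset Strict Implicit.
Unset Printing Implicit Defensive.
Import Order.TTheory GRing.Theory Num.Theory.
Local Open Scope ring_scope.

(* A finite simple graph on the vertex type T is a symmetric irreflexive
   relation e : rel T. *)

Definition graph_connected (T : finType) (e : rel T) : Prop :=
  (0 < #|T|)%N /\ forall x y : T, connect e x y.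

Definition walk_of_length (T : finType) (e : rel T) (x y : T) (n : nat) : bool :=
  [exists p : n.-tuple T, path e x p && (last x p == y)].

(* Least length of a walk from x to y. A shortest walk has pairwise distinct
   vertices, so lengths below #|T| suffice; the value is #|T| when y is not
   reachable from x, which does not happen in a connected graph. *)
Definition graph_dist (T : finType) (e : rel T) (x y : T) : nat :=
  find (walk_of_length e x y) (iota 0 #|T|).

Definition diameter (T : finType) (e : rel T) : nat :=
  (\max_(x : T) \max_(y : T) graph_dist e x y)%N.

Definition adjmx (R : pzRingType) (T : finType) (e : rel T) : 'M[R]_#|T| :=
  \matrix_(i, j) (e (enum_val i) (enum_val j))%:R.

(* [rootsR p] lists the distinct roots of p != 0 in R, and [mup x p] is the
   multiplicity of x as a root of p. *)
Definition neg_inertia (R : rcfType) (T : finType) (e : rel T) : nat :=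
  let p := char_poly (adjmx R e) in
  (\sum_(x <- rootsR p | (x < 0)%R) mup x p)%N.

(* Main.v *)
Require Import Defs.
From mathcomp Require Import all_boot all_order all_algebra.
From mathcomp Require Import polyrcf complex spectral sesquilinear zify.
Set Implicit Arguments.
Unset Strict Implicit.
Unset Printing Implicit Defensive.
Import Order.TTheory GRing.Theory Num.Theory.

(** A geodesic between two vertices at distance d = 2k + 1 is an induced path
    x_0, ..., x_d (lemma [induced_path]).  Let E and D select its even and odd
    vertices.  Each of the two classes is independent, so the adjacency form A
    vanishes on it, and the edges between the classes form the unitriangular
    matrix B = E A D^T.  On the (k + 1)-dimensional space spanned by the rows of
    V = D - B^T E the form is therefore V A V^T = - 2 B^T B, which is negative
    definite because B is invertible ([isotropic_pair_form],
    [path_matching_unitmx]).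

    A hermitian form that is negative definite on a space of dimension m has at
    least m negative eigenvalues ([negdef_leq_card], by the spectral theorem over
    R[i]).  Finally, the number of negative diagonal entries in a unitary
    diagonalization of A over R[i] is the number of negative roots, with
    multiplicity, of the characteristic polynomial over R ([neg_inertiaE]).
    Hence n(G) >= k + 1. *)

(** * Geodesics *)

Section Geodesic.
Variables (T : finType) (e : rel T).

Lemma walkP x y n :
  reflect (exists p, [/\ path e x p, last x p = y & size p = n])
          (walk_of_length e x y n).
Proof.
apply: (iffP existsP) => [[p /andP[pp /eqP lp]]|[p [pp lp sp]]].
  by exists p; rewrite size_tuple.
by exists (Tuple (introT eqP sp)); rewrite /= pp lp eqxx.
Qed.

Lemma graph_dist_le x p : path e x p -> (graph_dist e x (last x p) <= size p)%N.
Proof.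
move=> pp; rewrite leqNgt; apply/negP => lt_p.
have := @before_find _ 0%N (walk_of_length e x (last x p)) (iota 0 #|T|) _ lt_p.
have /(leq_trans lt_p) := find_size (walk_of_length e x (last x p)) (iota 0 #|T|).
rewrite size_iota => ltT; rewrite nth_iota // add0n => /walkP[].
by exists p.
Qed.

Lemma graph_dist_walk x y : connect e x y ->
  exists p, [/\ path e x p, last x p = y & size p = graph_dist e x y].
Proof.
case/connectP => p0 pp0 ->; case/shortenP: pp0 => p pp p_uniq _ {p0}.
set y' := last x p.
have lt_p : (size p < #|T|)%N.
  by have := max_card (mem (x :: p)); rewrite (card_uniqP p_uniq).
have hasw : has (walk_of_length e x y') (iota 0 #|T|).
  apply/hasP; exists (size p); first by rewrite mem_iota.
  by apply/walkP; exists p.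
have := nth_find 0%N hasw; move: (hasw); rewrite has_find size_iota => lt_f.
by rewrite nth_iota // add0n => /walkP.
Qed.

Lemma graph_dist_step x y z : connect e x y -> e y z ->
  (graph_dist e x z <= (graph_dist e x y).+1)%N.
Proof.
move=> /graph_dist_walk[p [pp lp <-]] eyz.
have -> : z = last x (rcons p z) by rewrite last_rcons.
by rewrite -(size_rcons p z) graph_dist_le // rcons_path pp lp.
Qed.

Lemma diameter_attained : (0 < #|T|)%N ->
  exists x y, graph_dist e x y = diameter e.
Proof.
move=> T0; rewrite /diameter.
have [x ->] := bigop.eq_bigmax (fun x => \max_y graph_dist e x y) T0.
by have [y ->] := bigop.eq_bigmax (graph_dist e x) T0; exists x, y.
Qed.

(** A walk of length [graph_dist e x y] from [x] to [y], as a sequence of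
    vertices indexed by their distance to [x]. *)
Lemma geodesic x y : connect e x y ->
  exists f : nat -> T,
    (forall i, i <= graph_dist e x y -> graph_dist e x (f i) = i)%N /\
    (forall i, i < graph_dist e x y -> e (f i) (f i.+1))%N.
Proof.
move=> /graph_dist_walk[p [pp lp sp]].
exists (nth x (x :: p)); rewrite -sp; split=> [i le_ip|i lt_ip]; last first.
  by have /pathP := pp; apply.
have lastE : nth x (x :: p) i = last x (take i p).
  rewrite (last_nth x) size_takel //.
  by rewrite -[x :: take i p]/(take i.+1 (x :: p)) nth_take.
apply/eqP; rewrite eqn_leq lastE; apply/andP; split.
  by rewrite -[leqRHS](size_takel le_ip) graph_dist_le ?take_path.
(* A shortcut to the i-th vertex, continued along p, would be a walk to y that
   is shorter than the distance from x to y. *)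
rewrite leqNgt; apply/negP => lt_i.
have /graph_dist_walk[q [pq lq sq]] : connect e x (last x (take i p)).
  by apply/connectP; exists (take i p); rewrite ?take_path.
have pqd : path e x (q ++ drop i p).
  by move: pp; rewrite -{1}(cat_take_drop i p) !cat_path pq lq => /andP[].
have := graph_dist_le pqd.
rewrite last_cat lq -last_cat cat_take_drop lp -sp size_cat size_drop sq.
lia.
Qed.

(** A geodesic of length [diameter e] is an induced path: the distances to its
    origin differ by at most one for adjacent vertices, and the i-th vertex of
    the geodesic is at distance i. *)
Lemma induced_path : symmetric e -> irreflexive e -> graph_connected e ->
  exists f : nat -> T, forall i j, (i <= diameter e)%N -> (j <= diameter e)%N ->
    e (f i) (f j) = (i == j.+1) || (j == i.+1).
Proof.
move=> e_sym e_irr [T0 e_conn].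
have [x [y <-]] := diameter_attained T0.
have [f [distf ef]] := geodesic (e_conn x y).
exists f => i j le_i le_j; apply/idP/idP; last first.
  by case/orP=> /eqP ijE; [rewrite e_sym|]; rewrite ijE ef // -ijE.
move=> efij; have := graph_dist_step (e_conn x _) efij.
have : e (f j) (f i) by rewrite e_sym.
move/(graph_dist_step (e_conn x _)); rewrite !distf //.
have : i != j by apply/eqP => ij; move: efij; rewrite ij e_irr.
lia.
Qed.
End Geodesic.

(** * Negative eigenvalues of hermitian matrices *)

Local Open Scope ring_scope.
Local Open Scope sesquilinear_scope.

Lemma char_poly_conj (F : fieldType) n (P A : 'M[F]_n) :
  P \in unitmx -> char_poly (invmx P *m A *m P) = char_poly A.
Proof.
move=> Pu; rewrite /char_poly.
have -> : char_poly_mx (invmx P *m A *m P) =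
    map_mx polyC (invmx P) *m char_poly_mx A *m map_mx polyC P.
  rewrite /char_poly_mx !map_mxM mulmxBr mulmxBl; congr (_ - _).
  by rewrite -mulmxA mul_scalar_mx -scalemxAr -map_mxM mulVmx // map_mx1 scalemx1.
rewrite !det_mulmx mulrAC -det_mulmx -map_mxM mulVmx // map_mx1 det1.
exact: mul1r.
Qed.

Lemma char_poly_spectral (C : numClosedFieldType) n (A : 'M[C]_n) :
  A \is normalmx ->
  char_poly A = \prod_(i < n) ('X - (spectral_diag A 0 i)%:P).
Proof.
move=> /orthomx_spectralP {1}->; rewrite char_poly_conj ?spectral_unit //.
rewrite char_poly_trig ?diag_mx_is_trig //.
by apply: eq_bigr => i _; rewrite mxE eqxx.
Qed.

(** The easy half of the minimax principle: the number of negative eigenvalues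
    of [A] is at least the dimension of a space on which the form of [A] is
    negative definite. *)
Lemma negdef_leq_card (C : numClosedFieldType) m n
    (A : 'M[C]_n) (V : 'M[C]_(m, n)) :
    A \is hermsymmx ->
    (forall u : 'rV[C]_m, u != 0 -> (u *m V *m A *m (u *m V)^t*) 0 0 < 0) ->
  (m <= #|[pred i | (spectral_diag A 0 i < 0)%R]|)%N.
Proof.
move=> Aherm negV; rewrite leqNgt; apply/negP => ltNm.
pose P := spectralmx A; pose N := [pred i | (spectral_diag A 0 i < 0)%R].
pose W := colsub (@enum_val _ N) (V *m P^t*).
(* The coordinates of u *m V along the eigenvectors with negative eigenvalue
   are u *m W; with fewer than m of them, they all vanish for some nonzero u. *)
have [u uW u0] : exists2 u : 'rV[C]_m, (u <= kermx W)%MS & u != 0.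
  apply/rowV0Pn; rewrite -mxrank_eq0 mxrank_ker subn_eq0 -ltnNge.
  exact: leq_ltn_trans (rank_leq_col W) ltNm.
have {}uW : u *m W = 0 by exact/sub_kermxP.
have Pu : P \is unitarymx by exact: spectral_unitarymx.
have /hermitian_normalmx/orthomx_spectralP Adef := Aherm.
have := negV u u0; rewrite {1}Adef -/P invmx_unitary //.
set w := u *m V *m P^t*.
(* In the eigenbasis the form at u *m V is the sum of the d_i |w_i|^2. *)
have -> : u *m V *m (P^t* *m diag_mx (spectral_diag A) *m P) *m (u *m V)^t* =
   w *m diag_mx (spectral_diag A) *m w^t*.
  by rewrite /w [in RHS]trmx_mul [in RHS]map_mxM trmxCK !mulmxA.
have w0 i : i \in N -> w 0 i = 0.
  move=> iN; have /rowP/(_ (enum_rank_in iN i)) := uW.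
  rewrite /W mulmx_colsub mxE enum_rankK_in // mulmxA -/w mxE => ->.
  by rewrite mxE.
clearbody w; suff /le_gtF-> : 0 <= (w *m diag_mx (spectral_diag A) *m w^t*) 0 0 by [].
rewrite mxE; apply: sumr_ge0 => i _.
rewrite mul_mx_diag !mxE mulrAC.
have [iN|] := boolP (i \in N); first by rewrite w0 // mul0r mul0r.
rewrite inE => Ni; rewrite mulr_ge0 ?mul_conjC_ge0 //.
have /mxOverP/(_ 0 i) := hermitian_spectral_diag_real Aherm.
by move=> dr; rewrite real_leNgt ?real0.
Qed.

(** The elements of [s] that satisfy [a] are counted by their values, which all
    occur in [r]. *)
Lemma sum_count_mem (T : eqType) (a : pred T) (r s : seq T) :
  uniq r -> {subset s <= r} ->
  (\sum_(x <- r | a x) count_mem x s)%N = count a s.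
Proof.
move=> r_uniq sub_sr.
under eq_bigr do rewrite -sum1_count.
rewrite (exchange_big_dep predT) //= -sum1_count [RHS]big_mkcond /=.
rewrite [LHS]big_seq [RHS]big_seq; apply: eq_bigr => y /sub_sr yr.
rewrite -[LHS]/(\sum_(x <- r | a x && (y == x)) 1)%N.
rewrite sum1_count; case: ifP => ay.
  rewrite -[RHS]/(nat_of_bool true) -[in RHS]yr -count_uniq_mem //.
  by apply: eq_count => x /=; rewrite eq_sym; case: eqP => [->|]; rewrite ?ay ?andbF.
rewrite (@eq_count _ _ pred0) ?count_pred0 // => x /=.
by rewrite eq_sym; case: eqP => [->|]; rewrite ?ay ?andbF.
Qed.

(** * The negative inertia index as a number of eigenvalues *)

Section Inertia.
Variables (R : rcfType) (T : finType) (e : rel T).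

Lemma map_adjmx (S : pzRingType) (f : {rmorphism R -> S}) :
  map_mx f (adjmx R e) = adjmx S e.
Proof. by apply/matrixP=> i j; rewrite !mxE rmorph_nat. Qed.

Lemma adjmx_herm (C : numClosedFieldType) : symmetric e -> adjmx C e \is hermsymmx.
Proof.
move=> e_sym; apply: realsym_hermsym; last first.
  by apply/mxOverP => i j; rewrite mxE realn.
apply/is_hermitianmxP; rewrite expr0 scale1r.
by apply/matrixP => i j; rewrite !mxE e_sym.
Qed.

(** The eigenvalues of the adjacency matrix over [R[i]] are real, hence they are
    the roots, with multiplicity, of its characteristic polynomial over [R]. *)
Lemma neg_inertiaE : symmetric e ->
  neg_inertia R e =
    #|[pred i | (spectral_diag (adjmx R[i] e) 0 i < 0)%R]|.
Proof.
move=> e_sym; have Aherm := adjmx_herm (R[i]) e_sym.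
set d := spectral_diag _; pose r i := complex.Re (d 0 i).
have dr i : d 0 i = ((r i)%:C)%C.
  rewrite /r RRe_real //.
  exact: (mxOverP (hermitian_spectral_diag_real Aherm)).
have pE : char_poly (adjmx R e) = \prod_(x <- codom r) ('X - x%:P).
  apply: (map_poly_inj (real_complex R)).
  rewrite map_char_poly map_adjmx.
  rewrite char_poly_spectral ?hermitian_normalmx // big_image rmorph_prod /=.
  by apply: eq_bigr => i _; rewrite -/d dr rmorphB /= map_polyX map_polyC.
have p0 : char_poly (adjmx R e) != 0 by rewrite monic_neq0 ?char_poly_monic.
rewrite /neg_inertia /=.
under eq_bigr do rewrite pE mu_prod_XsubC.
rewrite sum_count_mem ?uniq_roots //; last first.
  move=> x xr; have /(_ x) := roots_on_rootsR p0.
  by rewrite in_itv /= => <-; rewrite pE root_prod_XsubC.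
rewrite count_map -size_filter [RHS]cardE /enum_mem filter_predT.
congr size; apply: eq_filter => i.
by rewrite /= inE dr -(rmorph0 (real_complex R)) ltcR.
Qed.
End Inertia.

(** * A negative definite subspace from an induced path *)

(** The form of [A] vanishes on the row spaces of [D] and [E], which it pairs
    through [B]; correcting the rows of [D] by [- B^T] times those of [E] turns
    it into the negative of a Gram matrix, doubled. *)
Lemma isotropic_pair_form (F : comPzRingType) k n (A : 'M[F]_n) (D E : 'M[F]_(k, n))
    (B : 'M[F]_k) :
    D *m A *m D^T = 0 -> E *m A *m E^T = 0 ->
    E *m A *m D^T = B -> D *m A *m E^T = B^T ->
  (D - B^T *m E) *m A *m (D - B^T *m E)^T = - (B^T *m B) *+ 2.
Proof.
move=> DD EE ED DE.
rewrite linearB /= trmx_mul trmxK mulmxBr !mulmxBl !mulmxA.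
have -> : B^T *m E *m A *m D^T = B^T *m B by rewrite -ED !mulmxA.
have -> : B^T *m E *m A *m E^T *m B = 0.
  by rewrite -(mulmxA _ A) -(mulmxA _ E) (mulmxA E) EE mulmx0 mul0mx.
by rewrite DE DD subr0 sub0r -opprD mulNrn mulr2n.
Qed.

(** The biadjacency matrix of a path with 2k vertices numbered from 0: the
    i-th even vertex 2i is adjacent to the odd vertices 2i + 1 and 2i - 1. *)
Lemma path_matching_unitmx (F : fieldType) k :
  (\matrix_(i < k, j < k) ((i == j) || (i == j.+1 :> nat))%:R : 'M[F]_k)
    \in unitmx.
Proof.
rewrite unitmxE det_trig; first by rewrite big1 ?unitr1 // => i _; rewrite mxE eqxx.
apply/is_trig_mxP => i j lt_ij; rewrite mxE -val_eqE.
rewrite (_ : (_ || _) = false) //=; lia.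
Qed.

(** [rowsub g 1%:M] is the matrix that selects the coordinates [g i]. *)
Lemma mulmx_rowsub1 (F : pzRingType) m n p (g : 'I_m -> 'I_n) (h : 'I_p -> 'I_n)
    (A : 'M[F]_n) :
  rowsub g 1%:M *m A *m (rowsub h 1%:M)^T = mxsub g h A.
Proof.
by rewrite -rowsubE trmx_mxsub trmx1 mulmx_colsub mulmx1 -mxsub_comp.
Qed.

Theorem lemma2p8 (R : rcfType) (T : finType) (e : rel T) (k : nat)
    (e_sym : symmetric e) (e_irr : irreflexive e)
    (e_conn : graph_connected e)
    (diam_e : diameter e = (2 * k + 1)%N) :
  (diameter e + 1 <= 2 * neg_inertia R e)%N.
Proof.
have [f ef] := induced_path e_sym e_irr e_conn.
rewrite neg_inertiaE // diam_e.
suff : (k.+1 <= #|[pred i | (spectral_diag (adjmx R[i] e) 0 i < 0)%R]|)%N.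
  by move: #|_| => N; lia.
pose sel (g : 'I_k.+1 -> nat) : 'M[R[i]]_(k.+1, #|T|) :=
  rowsub (fun i => enum_rank (f (g i))) 1%:M.
pose D := sel (fun i => (2 * i).+1); pose E := sel (fun i => (2 * i)%N).
pose B : 'M[R[i]]_k.+1 := \matrix_(i, j) ((i == j) || (i == j.+1 :> nat))%:R.
have selE (g h : 'I_k.+1 -> nat) :
    (forall i, (g i <= 2 * k + 1)%N) -> (forall i, (h i <= 2 * k + 1)%N) ->
    sel g *m adjmx R[i] e *m (sel h)^T =
    \matrix_(i, j) ((g i == (h j).+1) || (h j == (g i).+1))%:R.
  move=> gle hle; rewrite mulmx_rowsub1; apply/matrixP => i j.
  by rewrite !mxE !enum_rankK ef ?diam_e.
pose V := D - B^T *m E.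
have formV : V *m adjmx R[i] e *m V^T = - (B^T *m B) *+ 2.
  have odd_le (i : 'I_k.+1) : ((2 * i).+1 <= 2 * k + 1)%N.
    by have := ltn_ord i; lia.
  have even_le (i : 'I_k.+1) : (2 * i <= 2 * k + 1)%N by apply: ltnW.
  apply: isotropic_pair_form; rewrite selE //; apply/matrixP => i j; rewrite !mxE.
  - by rewrite (_ : (_ || _) = false) //; lia.
  - by rewrite (_ : (_ || _) = false) //; lia.
  - by rewrite -val_eqE /=; congr (_%:R); lia.
  - by rewrite -val_eqE /=; congr (_%:R); lia.
have real_sel g : map_mx Num.conj (sel g) = sel g.
  by apply/matrixP => i j; rewrite !mxE conjC_nat.
have real_B : map_mx Num.conj B = B.
  by apply/matrixP => i j; rewrite !mxE conjC_nat.
have real_V : map_mx Num.conj V^T = V^T.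
  by rewrite -map_trmx /V map_mxB map_mxM -map_trmx real_B !real_sel.
apply: (@negdef_leq_card _ _ _ _ V (adjmx_herm _ e_sym)) => u u0.
rewrite trmx_mul map_mxM real_V mulmxA -(mulmxA u V) -(mulmxA u _ V^T) formV.
(* The form takes at u *m V the value - 2 |w|^2 with w = u *m B^T. *)
set w := u *m B^T.
have -> : u *m (- (B^T *m B) *+ 2) *m u^t* = - (w *m w^t*) *+ 2.
  rewrite /w [in RHS]trmx_mul trmxK [in RHS]map_mxM real_B !mulmxA.
  by rewrite !mulr2n mulmxDr mulmxDl mulmxN mulNmx !mulmxA.
have w0 : w != 0.
  apply: contraNneq u0 => /(congr1 (mulmxr (invmx B^T))) /=.
  by rewrite mulmxK ?unitmx_tr ?path_matching_unitmx // mul0mx => ->.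
by rewrite mulNrn mxE mulr2n mxE oppr_lt0 -dotmxE addr_gt0 ?dnorm_gt0.
Qed.
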